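(* Given $f\in\mathbb{Z}^3\setminus\{0\}$, $\mu>0$, $\lambda+\mu>0$, and constants $A^{pm}_{nr}$ ($1\le p,m,n,r\le3$), one can find a nontrivial planar wave solution $w_{A,f}:[0,\infty)\times\mathbb{T}^3\to\mathbb{C}^3$ to the equation $$\partial_{tt}w_{A,f}-\mu\Delta w_{A,f}-(\lambda+\mu)\nabla(\operatorname{div}w_{A,f})+A(\nabla^2w_{A,f})=0.$$ In particular, the solution can have the expression $$w_{A,f}=\Big(f+a_{A,2}f^{\perp}+a_{A,3}\tfrac{f}{|f|}\times f^{\perp}\Big)e^{i\xi_{A,f}},$$ where $f^{\perp}\in\mathbb{Q}^3$ satisfies $f^{\perp}\perp f$ and $|f^{\perp}|=|f|$, $\xi_{A,f}=f\cdot x-\big((\lambda+2\mu)|f|^2-c_A\big)^{1/2}t$, $a_{A,2},a_{A,3}$ are constants, and $c_A$ is a constant depending on the coefficients $A^{pm}_{nr}$ and $|f|$. Moreover, there exists $\varepsilon_0(\lambda,\mu,C)>0$ such that, for any $\varepsilon<\varepsilon_0$, if $|A^{pm}_{nr}|\le C\varepsilon$, then $$|a_{A,2}|+|a_{A,3}|\le C'\varepsilon\le\tfrac1{10},\qquad |c_A|\le C''\varepsilon|f|^2,$$ where $C'$ depends only on $\lambda,\mu,C$ and $C''$ depends only on $C$.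
   Context: $\mathbb{T}=[-\pi,\pi]$ (periodic). For a vector-valued function $w=(w_1,w_2,w_3)$, $A(\nabla^2w)$ is the vector with components $(A(\nabla^2w))_p=A^{pm}_{nr}\,\partial_n\partial_rw_m$, summed over the repeated indices $m,n,r$. $C>0$ is a given constant.
   Formalization: The expression is claimed only for A admitting a planar wave with amplitude not orthogonal to f (necessary; proved when |A|≤Cε, ε<ε₀); f^⊥ is any real vector with f^⊥⊥f, |f^⊥|=|f| (a rational one may not exist); c_A may depend on f, λ, μ, not just A and |f|. *)

(* Defs.v *)
From mathcomp Require Import all_boot all_order all_algebra.
From mathcomp Require Import complex.
From mathcomp Require Import all_classical all_reals all_analysis.

Set Implicit Arguments.
Unset Strict Implicit.
Unset Printing Implicit Defensive.

Import Order.TTheory GRing.Theory Num.Theory.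
Import numFieldNormedType.Exports.

Local Open Scope ring_scope.
Local Open Scope complex_scope.

(* Bilinear over R[i] as well: no conjugation. *)
Definition dotprod (K : comNzRingType) (u v : 'rV[K]_3) : K := (u *m v^T) 0 0.

(* Indices are added modulo 3. *)
Definition crossprod (K : comNzRingType) (u v : 'rV[K]_3) : 'rV[K]_3 :=
  \row_(k < 3) (u 0 (k + 1) * v 0 (k + 2%:R) - u 0 (k + 2%:R) * v 0 (k + 1)).

(* The Euclidean norm; the library's `|u| on row vectors is the sup norm. *)
Definition enorm (R : realType) (u : 'rV[R]_3) : R := Num.sqrt (dotprod u u).

Definition cvec (R : realType) (u : 'rV[R]_3) : 'rV[R[i]]_3 :=
  map_mx (real_complex R) u.

Definition intvec (R : realType) (f : 'rV[int]_3) : 'rV[R]_3 :=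
  map_mx intr f.

Definition cexp (R : realType) (z : R[i]) : R[i] :=
  (expR (complex.Re z))%:C * (cos (complex.Im z) +i* sin (complex.Im z)).

Section PDE.
Variable R : realType.

(* R[i] has no normed R-module structure in the library: complex-valued
   functions are differentiated through their real and imaginary parts. *)
Definition cderivable (V : normedModType R) (g : V -> R[i]) (x v : V) : Prop :=
  derivable (fun y => complex.Re (g y) : R^o) x v /\
  derivable (fun y => complex.Im (g y) : R^o) x v.

Definition cderive (V : normedModType R) (g : V -> R[i]) (x v : V) : R[i] :=
  'D_v (fun y => complex.Re (g y) : R^o) x +i*
  'D_v (fun y => complex.Im (g y) : R^o) x.

Definition scalar_field := R -> 'rV[R]_3 -> R[i].
Definition vector_field := R -> 'rV[R]_3 -> 'rV[R[i]]_3.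

Implicit Types (u : scalar_field) (w : vector_field).

Definition component w (p : 'I_3) : scalar_field := fun t x => w t x 0 p.

Definition dt u : scalar_field :=
  fun t x => cderive (fun s : R^o => u s x) t 1.

Definition dx (n : 'I_3) u : scalar_field :=
  fun t x => cderive (u t) x (delta_mx 0 n).

Definition dt_exists u (t : R) (x : 'rV[R]_3) : Prop :=
  cderivable (fun s : R^o => u s x) t 1.

Definition dx_exists (n : 'I_3) u (t : R) (x : 'rV[R]_3) : Prop :=
  cderivable (u t) x (delta_mx 0 n).

Definition laplacian u : scalar_field :=
  fun t x => \sum_(n < 3) dx n (dx n u) t x.

Definition divergence w : scalar_field :=
  fun t x => \sum_(m < 3) dx m (component w m) t x.

(* The (p, m, n, r) entry is A^{pm}_{nr}. *)
Definition coefficients := 'I_3 -> 'I_3 -> 'I_3 -> 'I_3 -> R[i].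

Definition A_hess (A : coefficients) w (p : 'I_3) : scalar_field :=
  fun t x => \sum_(m < 3) \sum_(n < 3) \sum_(r < 3)
    A p m n r * dx n (dx r (component w m)) t x.

(* Functions on the torus are the functions on R^3 which are 2 pi-periodic in
   every coordinate. *)
Definition torus_periodic w : Prop :=
  forall (t : R) (x : 'rV[R]_3) (j : 'I_3),
    0 <= t -> w t (x + (2 * pi) *: delta_mx 0 j) = w t x.

Definition twice_derivable w : Prop :=
  forall (t : R) (x : 'rV[R]_3) (p : 'I_3), 0 <= t ->
    [/\ dt_exists (component w p) t x, dt_exists (dt (component w p)) t x,
        forall n, dx_exists n (component w p) t x
      & forall n r, dx_exists n (dx r (component w p)) t x].

(* A field is given by a function of all real times, of which only its
   restriction to t >= 0 matters, except that at t = 0 the time derivatives are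
   two-sided (hence stronger than one-sided ones). *)
Definition solution (lam mu : R) (A : coefficients) w : Prop :=
  [/\ torus_periodic w, twice_derivable w &
    forall (t : R) (x : 'rV[R]_3) (p : 'I_3), 0 <= t ->
      dt (dt (component w p)) t x - mu%:C * laplacian (component w p) t x
      - (lam + mu)%:C * dx p (divergence w) t x + A_hess A w p t x = 0].

Definition nontrivial w : Prop :=
  exists (t : R) (x : 'rV[R]_3), 0 <= t /\ w t x != 0.

(* The frequency om is complex since om ^+ 2 need not be a nonnegative real. *)
Definition plane_wave (f : 'rV[int]_3) (om : R[i]) (v : 'rV[R[i]]_3) :
    vector_field :=
  fun t x => cexp ('i * ((dotprod (intvec R f) x)%:C - om * t%:C)) *: v.

Definition w_Af (lam mu : R) (f : 'rV[int]_3) (fperp : 'rV[R]_3)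
    (a2 a3 c : R[i]) : vector_field :=
  let fR := intvec R f in
  plane_wave f
    (sqrtc (((lam + 2 * mu) * enorm fR ^+ 2)%:C - c))
    (cvec fR + a2 *: cvec fperp
             + a3 *: cvec (crossprod ((enorm fR)^-1 *: fR) fperp)).

(* The form w_Af, in which f has coefficient 1, requires this. It can fail when
   A is large: for f = (1, 0, 0), the matrix
   mu |f|^2 I + (lam + mu) f f^T - A_f, with (A_f)_{pm} the sum over n and r of
   A^{pm}_{nr} f_n f_r, can be a nilpotent Jordan block whose only eigenvectors
   are orthogonal to f. *)
Definition has_nontransverse_wave (lam mu : R) (A : coefficients)
    (f : 'rV[int]_3) : Prop :=
  exists (om : R[i]) (v : 'rV[R[i]]_3),
    solution lam mu A (plane_wave f om v) /\ dotprod (cvec (intvec R f)) v != 0.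

Definition small (A : coefficients) (d : R) : Prop :=
  forall p m n r, Normc.normc (A p m n r) <= d.

Definition real_coefficients (A : coefficients) : Prop :=
  forall p m n r, A p m n r \is Num.real.

End PDE.

(* Main.v *)
Require Import Defs.
From mathcomp Require Import all_boot all_order all_algebra.
From mathcomp Require Import complex.
From mathcomp Require Import all_classical all_reals all_analysis.
From mathcomp Require Import ring lra.

(** Inserting exp(i (f . x - om t)) v into the equation turns every derivative
    into a multiplication, so the plane wave is a solution exactly when v is an
    eigenvector, with eigenvalue om ^ 2, of a constant 3 x 3 complex matrix
    ([solution_plane_wave]).  An eigenvector always exists over R[i], which
    gives the unrestricted existence statement.

    Dividing by |f| ^ 2 and writing e = f / |f|, L = lam + mu, the matrix
    becomes mu I + L e e^T - B with B of size O(eps) ([symbol_perturbed]).  The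
    unperturbed matrix has the simple eigenvalue mu + L = lam + 2 mu on the line
    of e and the double eigenvalue mu on the orthogonal plane.  For a small B
    the following perturbation argument is used.
    - Projecting an eigenvector equation along e and across e shows that each
      eigenvalue lies within L / 4 of mu or of mu + L ([eigenvalue_dichotomy]).
    - The three eigenvalues add up to the trace 3 mu + L - tr B, so they cannot
      all be close to mu ([exists_near_eigenvector]).
    - An eigenvector v for an eigenvalue close to mu + L is not orthogonal to
      e; once v . e = 1, the same two projections give |v - e| = O(B / L) and
      an eigenvalue that is mu + L + O(B) ([near_eigenvector],
      [near_eigenvalue]).  The last bound does not involve lam and mu, which
      is why C'' depends on C alone.
    - Such a v is unique ([near_unique]), so for real coefficients it coincides
      with its complex conjugate ([near_eigenvector_real]).

    Finally f, fperp and (f / |f|) x fperp are orthogonal of the same length, so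
    the amplitude |f| v expands in them with coefficient 1 on f and coefficients
    v . fperp / |f|, v . ((f / |f|) x fperp) / |f| on the two others
    ([wave_frame_expansion]); both are bounded by the norm of v - e.  The
    constant c = |f| ^ 2 (mu + L - k), with k the eigenvalue of v, does not
    involve fperp. *)

Set Implicit Arguments.
Unset Strict Implicit.
Unset Printing Implicit Defensive.

Import Order.TTheory GRing.Theory Num.Theory.
Import numFieldNormedType.Exports.

Local Open Scope ring_scope.

(** * Plane waves as exponentials *)

Section Analysis.
Variable R : realType.
Local Open Scope complex_scope.

Lemma cexp0 : cexp (0 : R[i]) = 1.
Proof. by rewrite /cexp /= expR0 cos0 sin0 mul1r. Qed.

Lemma cexpD (z w : R[i]) : cexp (z + w) = cexp z * cexp w.
Proof.
case: z => a b; case: w => c d; rewrite /cexp /= expRD cosD sinD.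
by apply/eqP; rewrite eq_complex /=; apply/andP; split; apply/eqP; ring.
Qed.

Lemma cexp_neq0 (z : R[i]) : cexp z != 0.
Proof.
apply/eqP => z0; have := cexpD z (- z).
by rewrite subrr cexp0 z0 mul0r => /eqP; rewrite oner_eq0.
Qed.

(** Directional derivatives only see the restriction of g to a line, so it is
    enough to know that g is an exponential along that line; this covers the
    time derivative and all the space derivatives of a plane wave at once. *)
Lemma cexp_exponential (V : normedModType R) (g : V -> R[i]) (x v : V)
    (z : R[i]) :
  (forall h : R, g (h *: v + x) = cexp (h%:C * z) * g x) ->
  cderivable g x v /\ cderive g x v = z * g x.
Proof.
move=> gE; rewrite /cderivable /cderive.
case: z gE => a b; case gx: (g x) => [c d] gE.
(* The difference quotients of F at x along v are those of psi at 0. *)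
have restrict (F : V -> R^o) (psi : R -> R^o) (l : R) :
    (forall h : R, F (h *: v + x) = psi h) -> is_derive (0 : R) 1 psi l ->
    derivable F x v /\ 'D_v F x = l.
  move=> Fpsi [psid psil].
  have Fx : F x = psi 0 by rewrite -Fpsi scale0r add0r.
  have E : (fun h : R => h^-1 *: ((F \o shift x) (h *: v) - F x)) =
           (fun h : R => h^-1 *: ((psi \o shift 0) (h *: 1) - psi 0)).
    by apply/funext => h /=; rewrite Fpsi Fx addr0 [h *: 1]mulr1.
  rewrite /derivable /derive E; split; first exact: psid.
  exact: psil.
have reE (h : R) : complex.Re (g (h *: v + x)) =
    expR (h * a) * (cos (h * b) * c - sin (h * b) * d).
  by rewrite gE /cexp /= !mul0r !(subr0, addr0); ring.
have imE (h : R) : complex.Im (g (h *: v + x)) =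
    expR (h * a) * (cos (h * b) * d + sin (h * b) * c).
  by rewrite gE /cexp /= !mul0r !(subr0, addr0); ring.
have [|dr ->] := restrict (fun y => complex.Re (g y)) _ (a * c - b * d) reE.
  apply: is_derive_eq.
  by rewrite /= !mul0r expR0 cos0 sin0 /GRing.scale /=; ring.
have [|di ->] := restrict (fun y => complex.Im (g y)) _ (a * d + b * c) imE.
  apply: is_derive_eq.
  by rewrite /= !mul0r expR0 cos0 sin0 /GRing.scale /=; ring.
by split.
Qed.

(** The components of plane waves; applying [dx] or [dt] stays in this family
    and only multiplies the amplitude a. *)
Definition scalar_wave (f : 'rV[int]_3) (om a : R[i]) : scalar_field R :=
  fun t x => cexp ('i * ((dotprod (intvec R f) x)%:C - om * t%:C)) * a.

Definition wavevector (f : 'rV[int]_3) (n : 'I_3) : R[i] := (f 0 n)%:~R%:C.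

Lemma dotprodE (K : comNzRingType) (u v : 'rV[K]_3) :
  dotprod u v = \sum_j u 0 j * v 0 j.
Proof. by rewrite /dotprod mxE; apply: eq_bigr => j _; rewrite mxE. Qed.

Lemma dotprod_shift (u x : 'rV[R]_3) (h : R) (n : 'I_3) :
  dotprod u (h *: delta_mx 0 n + x) = h * u 0 n + dotprod u x.
Proof.
rewrite !dotprodE.
under eq_bigr do rewrite !mxE mulrDr.
rewrite big_split /=; congr (_ + _).
rewrite (bigD1 n) //= eqxx mulr1 big1 => [|j /negbTE jn].
  by rewrite addr0 mulrC.
by rewrite jn mulr0 mulr0.
Qed.

Lemma component_plane_wave f om v p :
  component (plane_wave f om v) p = scalar_wave f om (v 0 p).
Proof. by apply/funext => t; apply/funext => x; rewrite /component mxE. Qed.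

Lemma scalar_wave_dx f om a n t x :
  dx_exists n (scalar_wave f om a) t x /\
  dx n (scalar_wave f om a) t x = scalar_wave f om ('i * wavevector f n * a) t x.
Proof.
have [|d dE] := @cexp_exponential _ (scalar_wave f om a t) x (delta_mx 0 n)
  ('i * wavevector f n).
  move=> h; rewrite /scalar_wave mulrA -cexpD dotprod_shift; congr (cexp _ * _).
  by rewrite mxE rmorphD rmorphM /= /wavevector; ring.
by split => //; rewrite /dx dE /scalar_wave; ring.
Qed.

Lemma scalar_wave_dt f om a t x :
  dt_exists (scalar_wave f om a) t x /\
  dt (scalar_wave f om a) t x = scalar_wave f om (- 'i * om * a) t x.
Proof.
have [|d dE] := @cexp_exponential _ (fun s : R^o => scalar_wave f om a s x) t 1
  (- 'i * om).
  move=> h; rewrite /scalar_wave mulrA -cexpD; congr (cexp _ * _).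
  by rewrite [h *: 1]mulr1 rmorphD /=; ring.
by split => //; rewrite /dt dE /scalar_wave; ring.
Qed.

Lemma dxE f om a n :
  dx n (scalar_wave f om a) = scalar_wave f om ('i * wavevector f n * a).
Proof.
by apply/funext => t; apply/funext => x; have [] := scalar_wave_dx f om a n t x.
Qed.

Lemma dtE f om a : dt (scalar_wave f om a) = scalar_wave f om (- 'i * om * a).
Proof.
by apply/funext => t; apply/funext => x; have [] := scalar_wave_dt f om a t x.
Qed.

Lemma cexp_period (k : int) : cexp ('i * (k%:~R * (2 * pi))%:C) = 1 :> R[i].
Proof.
have natE n : cexp ('i * (n%:R * (2 * pi))%:C) = 1 :> R[i].
  elim: n => [|n IH]; first by rewrite mul0r rmorph0 mulr0 cexp0.
  rewrite -natr1 mulrDl rmorphD mulrDr cexpD IH !mul1r /cexp /=.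
  rewrite !mul0r !mul1r subr0 add0r expR0 mulr_natl cos2pi sin2pi.
  by rewrite mulr1.
case: k => n; first exact: natE.
apply: (mulfI (cexp_neq0 ('i * (n.+1%:R * (2 * pi))%:C))).
rewrite -cexpD NegzE natE mulr1 mulrNz mulNr.
by rewrite -mulrDr -rmorphD subrr mulr0 cexp0.
Qed.

(** The entries of f are integers, so a shift by 2 pi multiplies the wave by
    exp(2 pi i f_j) = 1. *)
Lemma plane_wave_periodic f om v :
  torus_periodic (plane_wave f om v : vector_field R).
Proof.
move=> t x j _; rewrite /plane_wave [x + _]addrC dotprod_shift; congr (_ *: _).
rewrite -[RHS]mul1r -(cexp_period (f 0 j)) -cexpD; congr cexp.
by rewrite mxE rmorphD /= [_ * (_)%:~R]mulrC; ring.
Qed.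

Lemma plane_wave_derivable f om v :
  twice_derivable (plane_wave f om v : vector_field R).
Proof.
move=> t x p _; rewrite component_plane_wave; split.
- by have [] := scalar_wave_dt f om (v 0 p) t x.
- by rewrite dtE; case: (scalar_wave_dt f om (- 'i * om * v 0 p) t x).
- by move=> n; have [] := scalar_wave_dx f om (v 0 p) n t x.
move=> n r; rewrite dxE.
by have [] := scalar_wave_dx f om ('i * wavevector f r * v 0 p) n t x.
Qed.

Lemma plane_wave_nontrivial f om v :
  v != 0 -> nontrivial (plane_wave f om v : vector_field R).
Proof.
move=> v0; exists 0, 0; split => //.
by rewrite /plane_wave scaler_eq0 negb_or cexp_neq0.
Qed.

(** The Fourier symbol of the operator mu Laplacian + (lam + mu) grad div - A,
    up to sign, transposed so that it acts on row vectors. *)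
Definition symbol (lam mu : R) (A : coefficients R) (f : 'rV[int]_3) :
    'M[R[i]]_3 :=
  \matrix_(m, p) (mu%:C * (\sum_n wavevector f n ^+ 2) * (m == p)%:R
    + (lam + mu)%:C * wavevector f m * wavevector f p
    - \sum_n \sum_r A p m n r * wavevector f n * wavevector f r).

(** Since [cexp] never vanishes, the exponential factors out of the equation and
    leaves a condition on the amplitude. *)
Lemma solution_plane_wave lam mu A f om v :
  solution lam mu A (plane_wave f om v) <->
  v *m symbol lam mu A f = om ^+ 2 *: v.
Proof.
have i2 : 'i * 'i = -1 :> R[i] by rewrite -expr2 sqr_i.
have equation t x p :
    let w := plane_wave f om v in
    dt (dt (component w p)) t x - mu%:C * laplacian (component w p) t x
      - (lam + mu)%:C * dx p (divergence w) t x + A_hess A w p t x =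
    scalar_wave f om ((v *m symbol lam mu A f - om ^+ 2 *: v) 0 p) t x.
  have divE : divergence (plane_wave f om v) =
      scalar_wave f om (\sum_m 'i * wavevector f m * v 0 m).
    apply/funext => s; apply/funext => y.
    rewrite /divergence /scalar_wave mulr_sumr; apply: eq_bigr => m _.
    by rewrite component_plane_wave dxE.
  rewrite /= divE /laplacian /A_hess !component_plane_wave !dtE.
  rewrite dxE !mxE.
  set E : R[i] := cexp ('i * ((dotprod (intvec R f) x)%:C - om * t%:C)).
  have ttE : scalar_wave f om (- 'i * om * (- 'i * om * v 0 p)) t x =
      E * - (om ^+ 2 * v 0 p).
    by rewrite /scalar_wave -/E; ring: i2.
  have lapE : \sum_n dx n (dx n (scalar_wave f om (v 0 p))) t x =
      E * - ((\sum_n wavevector f n ^+ 2) * v 0 p).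
    rewrite mulr_suml -sumrN mulr_sumr; apply: eq_bigr => n _.
    by rewrite !dxE /scalar_wave -/E; ring: i2.
  have gradE : scalar_wave f om
        ('i * wavevector f p * \sum_m 'i * wavevector f m * v 0 m) t x =
      E * - \sum_m wavevector f m * wavevector f p * v 0 m.
    rewrite /scalar_wave -/E; congr (_ * _).
    rewrite mulr_sumr -sumrN; apply: eq_bigr => n _; ring: i2.
  have hessE : \sum_m \sum_n \sum_r
        A p m n r * dx n (dx r (component (plane_wave f om v) m)) t x =
      E * - \sum_m v 0 m *
        \sum_n \sum_r A p m n r * wavevector f n * wavevector f r.
    rewrite -sumrN mulr_sumr; apply: eq_bigr => m _.
    rewrite mulr_sumr -sumrN mulr_sumr; apply: eq_bigr => n _.
    rewrite mulr_sumr -sumrN mulr_sumr; apply: eq_bigr => r _.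
    by rewrite component_plane_wave !dxE /scalar_wave -/E; ring: i2.
  rewrite ttE lapE gradE hessE /scalar_wave -/E.
  under [in RHS]eq_bigr do rewrite mxE mulrBr mulrDr.
  rewrite sumrB big_split /=.
  have -> : \sum_m v 0 m * (mu%:C * (\sum_n wavevector f n ^+ 2) * (m == p)%:R) =
      mu%:C * (\sum_n wavevector f n ^+ 2) * v 0 p.
    rewrite (bigD1 p) //= eqxx mulr1 [X in _ + X]big1 ?addr0 1?mulrC //.
    by move=> m /negbTE ->; rewrite !mulr0.
  have -> : \sum_m v 0 m * ((lam + mu)%:C * wavevector f m * wavevector f p) =
      (lam + mu)%:C * \sum_m wavevector f m * wavevector f p * v 0 m.
    by rewrite mulr_sumr; apply: eq_bigr => m _; ring.
  ring.
split=> [[_ _ sol]|eig].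
  apply/eqP; rewrite -subr_eq0; apply/eqP/rowP => p; rewrite [RHS]mxE; apply/eqP.
  have := sol 0 0 p (lexx _); rewrite equation /scalar_wave => /eqP.
  by rewrite mulf_eq0 (negbTE (cexp_neq0 _)).
split; [exact: plane_wave_periodic|exact: plane_wave_derivable|].
by move=> t x p _; rewrite equation eig subrr mxE /scalar_wave mulr0.
Qed.

End Analysis.

(** * Bilinear algebra in dimension three *)

Section Dot.
Variable K : comNzRingType.
Implicit Types (u v w : 'rV[K]_3) (a : K).

Lemma dotprodC u v : dotprod u v = dotprod v u.
Proof. by rewrite !dotprodE; apply: eq_bigr => j _; rewrite mulrC. Qed.

Lemma dotprodDl u v w : dotprod (u + v) w = dotprod u w + dotprod v w.
Proof. by rewrite /dotprod mulmxDl mxE. Qed.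

Lemma dotprodZl a u w : dotprod (a *: u) w = a * dotprod u w.
Proof. by rewrite /dotprod -scalemxAl mxE. Qed.

Lemma dotprodNl u w : dotprod (- u) w = - dotprod u w.
Proof. by rewrite -scaleN1r dotprodZl mulN1r. Qed.

Lemma dotprodZr a u w : dotprod u (a *: w) = a * dotprod u w.
Proof. by rewrite dotprodC dotprodZl dotprodC. Qed.

Lemma mulmx_rank1 v u w : v *m (u^T *m w) = dotprod v u *: w.
Proof. by rewrite mulmxA [v *m _]mx11_scalar mul_scalar_mx. Qed.

End Dot.

(** The second highest coefficient of the characteristic polynomial is both
    minus the trace and minus the sum of its roots. *)
Lemma sum_eigenvalues (K : closedFieldType) n (M : 'M[K]_n.+1) :
  exists rs : seq K,
    [/\ size rs = n.+1, {in rs, forall k, eigenvalue M k}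
      & \sum_(k <- rs) k = \tr M].
Proof.
have [rs rsE] := closed_field_poly_normal (char_poly M).
rewrite (monicP (char_poly_monic M)) scale1r in rsE.
have rs_size : size rs = n.+1.
  by apply: succn_inj; rewrite -(size_char_poly M) rsE size_prod_XsubC.
exists rs; split=> // [k krs|].
  by rewrite eigenvalue_root_char rsE root_prod_XsubC.
apply: oppr_inj; rewrite -char_poly_trace // rsE -coefPn_prod_XsubC rs_size //.
Qed.

(** * The complex modulus and the sum norm *)

Section Norm1.
Variable R : realType.
Local Notation C := R[i].
Local Notation normc := (@Normc.normc R).
Implicit Types (x y : C) (u v w : 'rV[C]_3).

Lemma normc_ge0 x : 0 <= normc x.
Proof. by case: x => a b; rewrite /= sqrtr_ge0. Qed.

Lemma normcB x y : normc (x - y) <= normc x + normc y.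
Proof. by rewrite -(normcN y) le_normcD. Qed.

Lemma normc_real (a : R) : normc a%:C%C = `|a|.
Proof. by rewrite /= expr0n addr0 sqrtr_sqr. Qed.

Lemma normc_eq0 x : (normc x == 0) = (x == 0).
Proof.
by apply/eqP/eqP => [/Normc.eq0_normc//|->]; rewrite Normc.normc0.
Qed.

Lemma normc_sum (I : finType) (F : I -> C) :
  normc (\sum_i F i) <= \sum_i normc (F i).
Proof.
elim/big_ind2: _ => // [|x a y b xa yb]; first by rewrite Normc.normc0.
exact: (le_trans (le_normcD _ _) (lerD xa yb)).
Qed.

Definition norm1 v : R := \sum_j normc (v 0 j).

Lemma norm1_ge0 v : 0 <= norm1 v.
Proof. by apply: sumr_ge0 => j _; exact: normc_ge0. Qed.

Lemma norm1_eq0 v : (norm1 v == 0) = (v == 0).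
Proof.
apply/eqP/eqP => [v0|->]; last first.
  by rewrite /norm1 big1 // => j _; rewrite mxE Normc.normc0.
apply/rowP => j; rewrite mxE; apply/eqP; rewrite -normc_eq0; apply/eqP.
move/eqP: v0; rewrite psumr_eq0 => [/allP|i _]; last exact: normc_ge0.
by move=> /(_ j); rewrite mem_index_enum => /(_ isT)/eqP.
Qed.

Lemma norm1D u v : norm1 (u + v) <= norm1 u + norm1 v.
Proof.
by rewrite -big_split; apply: ler_sum => j _; rewrite mxE le_normcD.
Qed.

Lemma norm1Z x v : norm1 (x *: v) = normc x * norm1 v.
Proof. by rewrite mulr_sumr; apply: eq_bigr => j _; rewrite mxE Normc.normcM. Qed.

Lemma norm1N v : norm1 (- v) = norm1 v.
Proof. by apply: eq_bigr => j _; rewrite mxE normcN. Qed.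

Lemma norm1_mulmx v (B : 'M[C]_3) (b : R) :
  (forall j k, normc (B j k) <= b) -> norm1 (v *m B) <= 3 * b * norm1 v.
Proof.
move=> Bb; apply: le_trans (_ : \sum_(k < 3) b * norm1 v <= _); last first.
  by rewrite sumr_const card_ord -[_ *+ 3]mulr_natl mulrA.
apply: ler_sum => k _; rewrite mxE mulr_sumr.
apply: le_trans (normc_sum _) _; apply: ler_sum => j _.
by rewrite Normc.normcM mulrC ler_wpM2r ?normc_ge0.
Qed.

Lemma normc_dotprod v u :
  (forall j, normc (u 0 j) <= 1) -> normc (dotprod v u) <= norm1 v.
Proof.
move=> u1; rewrite dotprodE; apply: le_trans (normc_sum _) _.
by apply: ler_sum => j _; rewrite Normc.normcM ler_piMr ?normc_ge0.
Qed.

End Norm1.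

(** * Perturbation of a rank one matrix plus a scalar *)

Section Perturbation.
Variables (R : realType) (mu L : R) (e : 'rV[R[i]]_3) (B : 'M[R[i]]_3).
Local Notation C := R[i].
Local Notation normc := (@Normc.normc R).
Local Open Scope complex_scope.
Hypotheses (L_gt0 : 0 < L) (e_unit : dotprod e e = 1).
Hypothesis e_le1 : forall j, normc (e 0 j) <= 1.
Implicit Types (k : C) (v : 'rV[C]_3) (b : R).

Definition perturbed : 'M[C]_3 := mu%:C%:M + L%:C *: (e^T *m e) - B.

Lemma norm1_unit : norm1 e <= 3.
Proof.
apply: le_trans (_ : \sum_(j < 3) 1 <= _); first exact: ler_sum.
by rewrite sumr_const card_ord.
Qed.

Lemma eigen_equation v k : v *m perturbed = k *: v ->
  (k - mu%:C) *: v = (L%:C * dotprod v e) *: e - v *m B.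
Proof.
rewrite /perturbed mulmxBr mulmxDr mul_mx_scalar -scalemxAr mulmx_rank1.
rewrite scalerA scalerBl => <-.
by rewrite addrC !addrA addNr add0r.
Qed.

(** The component of the eigenvector equation along e involves the gap
    k - (mu + L), and the one across e the gap k - mu; in both, the right-hand
    side is of the size of B. *)
Lemma eigen_along v k : v *m perturbed = k *: v ->
  (k - mu%:C - L%:C) * dotprod v e = - dotprod (v *m B) e.
Proof.
move=> /eigen_equation /(congr1 (fun u : 'rV[C]_3 => dotprod u e)) /=.
rewrite dotprodDl dotprodNl !dotprodZl e_unit => E.
by rewrite mulrBl E; ring.
Qed.

Lemma eigen_across v k : v *m perturbed = k *: v ->
  (k - mu%:C) *: (v - dotprod v e *: e) =
  dotprod (v *m B) e *: e - v *m B.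
Proof.
move=> vk; rewrite scalerBr (eigen_equation vk) scalerA addrAC -scalerBl.
congr (_ *: _ - _); have := eigen_along vk; rewrite mulrBl => E.
by apply: oppr_inj; rewrite -E; ring.
Qed.

Section Bounds.
Variable b : R.
Hypotheses (B_le : forall j l, normc (B j l) <= b).

Lemma norm1_mulB v : norm1 (v *m B) <= 3 * b * norm1 v.
Proof. exact: norm1_mulmx. Qed.

Lemma along_mulB v : normc (dotprod (v *m B) e) <= 3 * b * norm1 v.
Proof. exact: le_trans (normc_dotprod _ e_le1) (norm1_mulB v). Qed.

Lemma along_bound v k : v *m perturbed = k *: v ->
  normc (k - mu%:C - L%:C) * normc (dotprod v e) <= 3 * b * norm1 v.
Proof.
by move=> /eigen_along E; rewrite -Normc.normcM E normcN along_mulB.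
Qed.

Lemma across_bound v k : v *m perturbed = k *: v ->
  normc (k - mu%:C) * norm1 (v - dotprod v e *: e) <= 12 * b * norm1 v.
Proof.
move=> /eigen_across E; rewrite -norm1Z E; apply: le_trans (norm1D _ _) _.
rewrite norm1N norm1Z; have := norm1_mulB v; have := along_mulB v.
have := norm1_unit; have := normc_ge0 (dotprod (v *m B) e); nra.
Qed.

Lemma split_bound v :
  norm1 v <= norm1 (v - dotprod v e *: e) + 3 * normc (dotprod v e).
Proof.
rewrite -{1}[v](subrK (dotprod v e *: e)); apply: le_trans (norm1D _ _) _.
by rewrite lerD2l norm1Z mulrC ler_wpM2r ?normc_ge0 ?norm1_unit.
Qed.

Hypothesis b_small : 84 * b < L.

(** If both gaps were at least L / 4, the projections of v would add up to at
    most (4 * 12 + 3 * 4 * 3) b / L = 84 b / L times the norm of v. *)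
Lemma eigenvalue_dichotomy v k : v *m perturbed = k *: v -> v != 0 ->
  normc (k - mu%:C) < L / 4 \/ normc (k - mu%:C - L%:C) < L / 4.
Proof.
move=> vk v0; case: ltrP => [|far0]; first by left.
case: ltrP => [|farL]; first by right.
have v_gt0 : 0 < norm1 v by rewrite lt_def norm1_eq0 v0 norm1_ge0.
have := across_bound vk; have := along_bound vk; have := split_bound v.
have := norm1_ge0 (v - dotprod v e *: e); have := normc_ge0 (dotprod v e).
move=> s0 u0 nsplit al ac.
have hs := ler_wpM2r s0 farL; have hu := ler_wpM2r u0 far0.
have hn : 84 * b * norm1 v < L * norm1 v by rewrite ltr_pM2r.
have hL : L * norm1 v <=
    L * (norm1 (v - dotprod v e *: e) + 3 * normc (dotprod v e)).
  by rewrite ler_pM2l.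
by clear vk v0; lra.
Qed.

(** Otherwise the three eigenvalues would all be within L / 4 of mu, and their
    sum within 3 L / 4 of 3 mu, whereas the trace is within 3 b < L / 4 of
    3 mu + L. *)
Lemma exists_near_eigenvector : exists v k,
  [/\ v != 0, v *m perturbed = k *: v & normc (k - mu%:C - L%:C) < L / 4].
Proof.
have [rs [rs_size rs_eig rs_sum]] := sum_eigenvalues perturbed.
have [/hasP[k krs kL]|/hasPn far] :=
    boolP (has (fun k => normc (k - mu%:C - L%:C) < L / 4) rs).
  by have /eigenvalueP[v vk v0] := rs_eig k krs; exists v, k.
have near0 k : k \in rs -> normc (k - mu%:C) < L / 4.
  move=> krs; have /eigenvalueP[v vk v0] := rs_eig k krs.
  by case: (eigenvalue_dichotomy vk v0) => // kL; move: (far k krs); rewrite kL.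
have trE : \tr perturbed = mu%:C * 3 + L%:C - \tr B.
  rewrite /perturbed !linearD linearN /= mxtrace_scalar linearZ /=.
  rewrite mxtrace_mulC trace_mx11 -[(_ *m _) 0 0]/(dotprod e e) e_unit mulr1.
  by rewrite mulr_natr.
case: rs => [|k1 [|k2 [|k3 []]]] // in rs_size rs_sum near0 {far rs_eig} *.
have := near0 k1; have := near0 k2; have := near0 k3.
rewrite !inE !eqxx !orbT /= => /(_ isT) h3 /(_ isT) h2 /(_ isT) h1.
move: rs_sum; rewrite !big_cons big_nil addr0 trE => E.
have {}E : L%:C = (k1 - mu%:C) + (k2 - mu%:C) + (k3 - mu%:C) + \tr B.
  have -> : L%:C = mu%:C * 3 + L%:C - \tr B - mu%:C * 3 + \tr B by ring.
  by rewrite -E; ring.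
have trB : normc (\tr B) <= 3 * b.
  apply: le_trans (normc_sum _) _.
  apply: le_trans (_ : \sum_(j < 3) b <= _); first exact: ler_sum.
  by rewrite sumr_const card_ord mulr_natl.
have := congr1 normc E; rewrite normc_real gtr0_norm // => LE.
have := le_normcD (k1 - mu%:C + (k2 - mu%:C) + (k3 - mu%:C)) (\tr B).
have := le_normcD (k1 - mu%:C + (k2 - mu%:C)) (k3 - mu%:C).
have := le_normcD (k1 - mu%:C) (k2 - mu%:C).
have := L_gt0; have := b_small.
lra.
Qed.

Section Near.
Variables (v : 'rV[C]_3) (k : C).
Hypothesis vk : v *m perturbed = k *: v.
Hypothesis k_near : normc (k - mu%:C - L%:C) < L / 4.

Lemma near_far : 3 / 4 * L < normc (k - mu%:C).
Proof.
have : L%:C = k - mu%:C - (k - mu%:C - L%:C) by ring.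
move/(congr1 normc); rewrite normc_real gtr0_norm // => E.
have := normcB (k - mu%:C) (k - mu%:C - L%:C); rewrite -E.
have := k_near; lra.
Qed.

(** The part of v across e is at most a quarter of v, hence the part along e
    controls v. *)
Lemma near_norm : norm1 v <= 4 * normc (dotprod v e).
Proof.
have := split_bound v; have := across_bound vk; have := near_far.
have := norm1_ge0 (v - dotprod v e *: e); have := norm1_ge0 v.
have := b_small; have := L_gt0.
move: (norm1 (_ - _)) (norm1 v) (normc (dotprod _ _)) (normc _) => u n s x.
nra.
Qed.

Lemma near_along_neq0 : v != 0 -> dotprod v e != 0.
Proof.
apply: contraNneq => s0; rewrite -norm1_eq0 eq_le norm1_ge0 andbT.
by have := near_norm; rewrite s0 Normc.normc0 mulr0.
Qed.

Hypothesis v_along : dotprod v e = 1.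

Lemma near_norm4 : norm1 v <= 4.
Proof. by have := near_norm; rewrite v_along Normc.normc1 mulr1. Qed.

Lemma near_eigenvalue : normc (k - mu%:C - L%:C) <= 12 * b.
Proof.
have := along_bound vk; rewrite v_along Normc.normc1 mulr1.
have b0 : 0 <= b by apply: le_trans (B_le 0 0); exact: normc_ge0.
have := near_norm4; nra.
Qed.

Lemma near_eigenvector : norm1 (v - e) <= 64 * b / L.
Proof.
have := across_bound vk; rewrite v_along scale1r.
have b0 : 0 <= b by apply: le_trans (B_le 0 0); exact: normc_ge0.
rewrite ler_pdivlMr //.
have := near_norm4; have := near_far; have := norm1_ge0 (v - e).
have := L_gt0; nra.
Qed.

End Near.

(** Subtracting the two eigenvector equations bounds (k - mu) (v - v') by a
    multiple of b times the norm of v - v', while the modulus of k - mu exceeds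
    3 L / 4. *)
Lemma near_unique v v' k k' :
  v *m perturbed = k *: v -> normc (k - mu%:C - L%:C) < L / 4 ->
  dotprod v e = 1 ->
  v' *m perturbed = k' *: v' -> normc (k' - mu%:C - L%:C) < L / 4 ->
  dotprod v' e = 1 -> v = v'.
Proof.
move=> vk kL ve vk' kL' ve'.
have kk' : k - k' = - dotprod ((v - v') *m B) e.
  have := eigen_along vk; have := eigen_along vk'; rewrite ve ve' !mulr1.
  rewrite mulmxBl dotprodDl dotprodNl => E' E.
  rewrite opprD opprK -E.
  by rewrite -[dotprod _ _]opprK -E'; ring.
have : (k - mu%:C) *: (v - v') =
    dotprod ((v - v') *m B) e *: v' - (v - v') *m B.
  rewrite -[dotprod _ _]opprK -kk' opprB.
  rewrite scalerBr (eigen_equation vk) ve.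
  have := eigen_equation vk'; rewrite ve' => E'.
  rewrite [(k - mu%:C)](_ : _ = (k' - mu%:C) + (k - k')); last by ring.
  rewrite scalerDl E' mulmxBl scalerBl scalerBl.
  by apply/rowP => j; rewrite !mxE; ring.
move/(congr1 (@norm1 R)); rewrite norm1Z => E.
have := norm1D (dotprod ((v - v') *m B) e *: v') (- ((v - v') *m B)).
rewrite -E norm1N norm1Z.
have := near_norm4 vk' kL' ve'; have := near_far kL.
have := along_mulB (v - v'); have := norm1_mulB (v - v').
have := normc_ge0 (dotprod ((v - v') *m B) e).
have := norm1_ge0 (v - v'); have := L_gt0; have := b_small.
have := norm1_ge0 v'.
move=> v'0 bs L0; rewrite le_eqVlt => /predU1P[d0 _ _ _ _ _ _|d0].
  by apply/eqP; rewrite -subr_eq0 -norm1_eq0 -d0.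
move: (norm1 (v - v')) (norm1 v') (norm1 (_ *m _)) (normc _) (normc _)
  v'0 bs L0 d0.
move=> d n pd x s n0 bs L0 d0 s0 hpd hs hx hn h.
exfalso.
have : s * n <= 4 * s by nra.
have : 3 / 4 * L * d < x * d by rewrite ltr_pM2r.
nra.
Qed.

End Bounds.
End Perturbation.

(** * Orthonormal frames *)

Lemma sum3 (V : nmodType) (F : 'I_3 -> V) : \sum_j F j = F 0 + F 1 + F 2%:R.
Proof.
rewrite !big_ord_recl big_ord0 addr0 addrA.
by congr (F _ + F _ + F _); apply: val_inj.
Qed.

Section Frame.
Variable K : comNzRingType.
Implicit Types (u v w : 'rV[K]_3).

Lemma crossprodE u v :
  [/\ crossprod u v 0 0 = u 0 1 * v 0 2%:R - u 0 2%:R * v 0 1,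
      crossprod u v 0 1 = u 0 2%:R * v 0 0 - u 0 0 * v 0 2%:R
    & crossprod u v 0 2%:R = u 0 0 * v 0 1 - u 0 1 * v 0 0].
Proof.
by split; rewrite mxE; congr (u 0 _ * v 0 _ - u 0 _ * v 0 _); apply: val_inj.
Qed.

Lemma dotprod_crossprodl u v : dotprod u (crossprod u v) = 0.
Proof.
by rewrite dotprodE sum3; have [-> -> ->] := crossprodE u v; ring.
Qed.

Lemma dotprod_crossprodr u v : dotprod v (crossprod u v) = 0.
Proof.
by rewrite dotprodE sum3; have [-> -> ->] := crossprodE u v; ring.
Qed.

Lemma lagrange_identity u v : dotprod (crossprod u v) (crossprod u v) =
  dotprod u u * dotprod v v - dotprod u v ^+ 2.
Proof.
by rewrite !dotprodE !sum3; have [-> -> ->] := crossprodE u v; ring.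
Qed.

Lemma crossprodZr (a : K) u v : crossprod u (a *: v) = a *: crossprod u v.
Proof. by apply/rowP => j; rewrite !mxE; ring. Qed.

(** The matrix with rows u, v and u x v has a transpose that is its right
    inverse, hence also its left inverse. *)
Lemma frame_expansion u v w :
  dotprod u u = 1 -> dotprod v v = 1 -> dotprod u v = 0 ->
  w = dotprod w u *: u + dotprod w v *: v
      + dotprod w (crossprod u v) *: crossprod u v.
Proof.
move=> uu vv uv; pose z := crossprod u v.
pose row_of (i : 'I_3) := [:: u; v; z]`_i.
pose Q : 'M[K]_3 := \matrix_(i, j) row_of i 0 j.
have rowQ i : row i Q = row_of i by apply/rowP => j; rewrite !mxE.
have dotQ x i : (x *m Q^T) 0 i = dotprod x (row_of i).
  by rewrite -rowQ mxE dotprodE; apply: eq_bigr => j _; rewrite !mxE.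
have zz : dotprod z z = 1 by rewrite lagrange_identity uu vv uv; ring.
have QQ : Q *m Q^T = 1%:M.
  apply/row_matrixP => i; rewrite row_mul; apply/rowP => j.
  rewrite dotQ rowQ row1 mxE eqxx /=.
  have vu : dotprod v u = 0 by rewrite dotprodC.
  have uz : dotprod u z = 0 := dotprod_crossprodl u v.
  have vz : dotprod v z = 0 := dotprod_crossprodr u v.
  have zu : dotprod z u = 0 by rewrite dotprodC.
  have zv : dotprod z v = 0 by rewrite dotprodC.
  by case: i j => [[|[|[|//]]] ?] [[|[|[|//]]] ?].
rewrite -{1}[w]mulmx1 -(mulmx1C QQ) mulmxA mulmx_sum_row sum3.
by rewrite !rowQ !dotQ.
Qed.

End Frame.

Lemma dotprod_map (K K' : comNzRingType) (g : {rmorphism K -> K'})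
    (u v : 'rV[K]_3) : dotprod (map_mx g u) (map_mx g v) = g (dotprod u v).
Proof.
by rewrite !dotprodE rmorph_sum; apply: eq_bigr => j _; rewrite !mxE rmorphM.
Qed.

Lemma crossprod_map (K K' : comNzRingType) (g : {rmorphism K -> K'})
    (u v : 'rV[K]_3) :
  crossprod (map_mx g u) (map_mx g v) = map_mx g (crossprod u v).
Proof. by apply/rowP => j; rewrite !mxE rmorphB !rmorphM. Qed.

(** * Complex conjugation and real eigenvectors *)

Section Conj.
Variable R : realType.
Local Open Scope complex_scope.

Lemma normc_conjc (z : R[i]) : Normc.normc z^*%C = Normc.normc z.
Proof. by case: z => a b; rewrite /= sqrrN. Qed.

Lemma conjc_subr (z : R[i]) (a : R) : (z - a%:C)^*%C = z^*%C - a%:C.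
Proof.
by case: z => x y; apply/eqP; rewrite eq_complex /= !(oppr0, addr0) !eqxx.
Qed.

Lemma conjc_fixed_real (z : R[i]) : z^*%C = z -> z \is Num.real.
Proof.
case: z => a b [bb]; rewrite complex_real.
by apply/eqP; move: bb; lra.
Qed.

Lemma real_conjc_fixed (z : R[i]) : z \is Num.real -> z^*%C = z.
Proof. by move=> /complex_realP[k ->]; rewrite conjc_real. Qed.

Lemma map_conjc_cvec (u : 'rV[R]_3) : map_mx conjc (cvec u) = cvec u.
Proof. by apply/rowP => j; rewrite !mxE conjc_real. Qed.

(** The conjugates of v and k satisfy the same conditions as v and k. *)
Lemma near_eigenvector_real (mu L b : R) (u : 'rV[R]_3) (B : 'M[R[i]]_3) v k :
  0 < L -> dotprod (cvec u) (cvec u) = 1 ->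
  (forall j, Normc.normc (cvec u 0 j) <= 1) ->
  (forall j l, Normc.normc (B j l) <= b) -> 84 * b < L ->
  map_mx conjc B = B ->
  v *m perturbed mu L (cvec u) B = k *: v ->
  Normc.normc (k - mu%:C - L%:C) < L / 4 -> dotprod v (cvec u) = 1 ->
  map_mx conjc v = v /\ k^*%C = k.
Proof.
move=> L0 u1 ule Bb bL Breal vk kL ve.
have conjP : map_mx conjc (perturbed mu L (cvec u) B) =
    perturbed mu L (cvec u) B.
  rewrite /perturbed map_mxB Breal map_mxD map_mxZ map_mxM -map_trmx.
  rewrite map_conjc_cvec map_scalar_mx.
  have cr (a : R) : (@conjc R : {rmorphism R[i] -> R[i]}) a%:C = a%:C.
    exact: conjc_real.
  by rewrite !cr.
have vk' : map_mx conjc v *m perturbed mu L (cvec u) B = k^*%C *: map_mx conjc v.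
  by rewrite -[X in _ *m X]conjP -map_mxM vk map_mxZ.
have kL' : Normc.normc (k^*%C - mu%:C - L%:C) < L / 4.
  have -> : k^*%C - mu%:C - L%:C = (k - mu%:C - L%:C)^*%C.
    by rewrite !conjc_subr.
  by rewrite normc_conjc.
have ve' : dotprod (map_mx conjc v) (cvec u) = 1.
  by rewrite -{1}(map_conjc_cvec u) dotprod_map ve rmorph1.
have vv := near_unique L0 u1 ule Bb bL vk kL ve vk' kL' ve'.
split=> //; rewrite -vv in vk'.
have : k^*%C *: v = k *: v by rewrite -vk' -vk.
move/(congr1 (fun w : 'rV[R[i]]_3 => dotprod w (cvec u))).
by rewrite /= !dotprodZl ve !mulr1.
Qed.

End Conj.

(** * The normalized eigenvalue problem *)

Section Waves.
Variables (R : realType) (f : 'rV[int]_3).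
Hypothesis f_neq0 : f != 0.
Local Open Scope complex_scope.
Local Notation fR := (intvec R f).
Local Notation len := (enorm fR).

Lemma real_complex_neq0 (a : R) : a != 0 -> a%:C != 0 :> R[i].
Proof.
by move=> a0; rewrite -(rmorph0 (real_complex R)) (inj_eq (@complexI R)).
Qed.

Lemma dotprodxx_ge0 (u : 'rV[R]_3) : 0 <= dotprod u u.
Proof. by rewrite dotprodE; apply: sumr_ge0 => j _; rewrite -expr2 sqr_ge0. Qed.

Lemma enorm_sqr (u : 'rV[R]_3) : enorm u ^+ 2 = dotprod u u.
Proof. by rewrite sqr_sqrtr // dotprodxx_ge0. Qed.

Lemma len_gt0 : 0 < len.
Proof.
rewrite sqrtr_gt0 lt_def dotprodxx_ge0 andbT.
apply: contra f_neq0; rewrite dotprodE psumr_eq0 => [/allP f0|j _]; last first.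
  by rewrite -expr2 sqr_ge0.
apply/eqP/rowP => j; have := f0 j; rewrite mem_index_enum => /(_ isT).
by rewrite !mxE mulf_eq0 orbb intr_eq0 => /eqP.
Qed.

Definition direction : 'rV[R]_3 := len^-1 *: fR.

Lemma unit_scaling (u : 'rV[R]_3) :
  enorm u = len -> dotprod (len^-1 *: u) (len^-1 *: u) = 1.
Proof.
move=> ul; rewrite dotprodZl dotprodZr -enorm_sqr ul expr2 mulrA.
by rewrite -expr2 -exprMn mulVf ?expr1n // gt_eqF ?len_gt0.
Qed.

Lemma cvec_unit (u : 'rV[R]_3) :
  dotprod u u = 1 -> dotprod (cvec u) (cvec u) = 1.
Proof. by move=> u1; rewrite dotprod_map u1. Qed.

Lemma cvec_unit_le1 (u : 'rV[R]_3) j :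
  dotprod u u = 1 -> Normc.normc (cvec u 0 j) <= 1.
Proof.
move=> u1; rewrite mxE normc_real -[1]sqrtr1 -sqrtr_sqr ler_sqrt // -u1.
rewrite dotprodE (bigD1 j) //= -expr2 lerDl.
by apply: sumr_ge0 => i _; rewrite -expr2 sqr_ge0.
Qed.

(** The matrix B: the contribution of A to the symbol at the unit vector e. *)
Definition coupling (A : coefficients R) : 'M[R[i]]_3 :=
  \matrix_(m, p) \sum_n \sum_r
    A p m n r * cvec direction 0 n * cvec direction 0 r.

Lemma coupling_le (A : coefficients R) d :
  small A d -> forall m p, Normc.normc (coupling A m p) <= 9 * d.
Proof.
move=> Ad m p; rewrite mxE.
have E : \sum_(n < 3) \sum_(r < 3) d = 9 * d.
  by rewrite !sumr_const !card_ord -mulrnA mulr_natl.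
have u1 := unit_scaling (erefl len).
rewrite -E; apply: le_trans (normc_sum _) _; apply: ler_sum => n _.
apply: le_trans (normc_sum _) _; apply: ler_sum => r _.
rewrite !Normc.normcM.
apply: le_trans (ler_piMr _ (cvec_unit_le1 r u1)) _.
  by rewrite mulr_ge0 ?normc_ge0.
exact: le_trans (ler_piMr (normc_ge0 _) (cvec_unit_le1 n u1)) (Ad p m n r).
Qed.

Lemma coupling_real (A : coefficients R) :
  real_coefficients A -> map_mx conjc (coupling A) = coupling A.
Proof.
move=> Ar; apply/matrixP => m p; rewrite !mxE rmorph_sum.
apply: eq_bigr => n _; rewrite rmorph_sum; apply: eq_bigr => r _.
by rewrite !rmorphM /= real_conjc_fixed // !mxE !conjc_real.
Qed.

(** The symbol is homogeneous of degree 2 in f. *)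
Lemma symbol_perturbed lam mu A :
  symbol lam mu A f =
  (len ^+ 2)%:C *: perturbed mu (lam + mu) (cvec direction) (coupling A).
Proof.
have waveE n : wavevector R f n = len%:C * cvec direction 0 n.
  rewrite !mxE -rmorphM mulrA divff ?mul1r //.
  by rewrite gt_eqF ?len_gt0.
have normE : \sum_n wavevector R f n ^+ 2 = (len ^+ 2)%:C.
  rewrite enorm_sqr dotprodE rmorph_sum; apply: eq_bigr => n _.
  by rewrite !mxE expr2 -rmorphM.
apply/matrixP => m p; rewrite [LHS]mxE normE.
rewrite ![in RHS]mxE big_ord1 !mxE -/direction.
have -> : \sum_n \sum_r A p m n r * wavevector R f n * wavevector R f r =
    (len ^+ 2)%:C * coupling A m p.
  rewrite !mxE mulr_sumr; apply: eq_bigr => n _.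
  rewrite mulr_sumr; apply: eq_bigr => r _.
  by rewrite !waveE rmorphXn /=; ring.
by rewrite !waveE rmorphXn /= !mxE -mulr_natr; ring.
Qed.

Lemma symbol_eigen lam mu A (v : 'rV[R[i]]_3) k :
  v *m symbol lam mu A f = ((len ^+ 2)%:C * k) *: v <->
  v *m perturbed mu (lam + mu) (cvec direction) (coupling A) = k *: v.
Proof.
rewrite symbol_perturbed -scalemxAr -scalerA; split=> [|-> //].
by apply: scalerI; rewrite real_complex_neq0 // expf_neq0 // gt_eqF ?len_gt0.
Qed.

Lemma eigen_normalize (P : 'M[R[i]]_3) (e v : 'rV[R[i]]_3) k :
  v *m P = k *: v -> dotprod v e != 0 ->
  exists w, w *m P = k *: w /\ dotprod w e = 1.
Proof.
move=> vk ve; exists ((dotprod v e)^-1 *: v); split.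
  by rewrite -scalemxAl vk !scalerA mulrC.
by rewrite dotprodZl mulVf.
Qed.

(** Here 9 d is the bound b of [coupling_le] on the entries of B. *)
Lemma exists_near_wave mu L (A : coefficients R) d :
  0 < L -> small A d -> 84 * (9 * d) < L ->
  exists k v, [/\ v *m perturbed mu L (cvec direction) (coupling A) = k *: v,
    dotprod v (cvec direction) = 1
    & Normc.normc (k - mu%:C - L%:C) < L / 4].
Proof.
move=> L0 /coupling_le Bd dL; have u1 := unit_scaling (erefl len).
have e1 := cvec_unit u1; have e_le j := cvec_unit_le1 j u1.
have [v [k [v0 vk kL]]] := exists_near_eigenvector mu L0 e1 e_le Bd dL.
have ve := near_along_neq0 L0 e1 e_le Bd dL vk kL v0.
by have [w [wk we]] := eigen_normalize vk ve; exists k, w.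
Qed.

Lemma wave_frame_expansion (fperp : 'rV[R]_3) (v : 'rV[R[i]]_3) :
  dotprod fR fperp = 0 -> enorm fperp = len ->
  dotprod v (cvec direction) = 1 ->
  let u := len^-1 *: fperp in
  cvec fR + dotprod v (cvec u) *: cvec fperp
    + dotprod v (cvec (crossprod direction u)) *:
        cvec (crossprod (len^-1 *: fR) fperp) = len%:C *: v.
Proof.
move=> fperp_orth fperp_len ve u.
have u1 := unit_scaling (erefl len); rewrite -/direction in u1.
have u2 : dotprod u u = 1 := unit_scaling fperp_len.
have u12 : dotprod direction u = 0.
  by rewrite dotprodZl dotprodZr fperp_orth !mulr0.
have lenK : len%:C * (len^-1)%:C = 1 :> R[i].
  by rewrite -rmorphM divff ?gt_eqF ?len_gt0 ?rmorph1.
have scaleK (x : R[i]) (w : 'rV[R]_3) :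
    (len%:C * x) *: cvec (len^-1 *: w) = x *: cvec w.
  by rewrite /cvec map_mxZ scalerA [_ * x]mulrC -mulrA lenK mulr1.
rewrite [in RHS](frame_expansion v (cvec_unit u1) (cvec_unit u2)); last first.
  by rewrite dotprod_map u12 rmorph0.
rewrite ve scale1r crossprod_map -/(cvec (crossprod direction u)).
rewrite !scalerDr !scalerA.
have -> : len%:C *: cvec direction = cvec fR.
  by rewrite -[_%:C]mulr1 scaleK scale1r.
by rewrite /u crossprodZr !scaleK.
Qed.

(** e is orthogonal to u, so only v - e contributes. *)
Lemma transverse_amplitude (u : 'rV[R]_3) (v : 'rV[R[i]]_3) :
  dotprod u u = 1 -> dotprod direction u = 0 ->
  Normc.normc (dotprod v (cvec u)) <= norm1 (v - cvec direction).
Proof.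
move=> uu du.
have -> : dotprod v (cvec u) = dotprod (v - cvec direction) (cvec u).
  by rewrite dotprodDl dotprodNl dotprod_map du rmorph0 subr0.
by apply: normc_dotprod => j; exact: cvec_unit_le1.
Qed.

End Waves.

(** * Existence and size of the planar waves *)

(* fperp ranges over all real vectors, in particular over the rational ones:
   some f, such as (1, 1, 1), have no rational fperp. *)
Theorem lemma3p4 (R : realType) (C : R) (C_gt0 : 0 < C) :
  exists C'' : R, forall lam mu : R, 0 < mu -> 0 < lam + mu ->
  exists C' eps0 : R, 0 < eps0 /\
  forall (f : 'rV[int]_3) (A : coefficients R), f != 0 ->
  [/\ exists (om : R[i]) (v : 'rV[R[i]]_3),
        solution lam mu A (plane_wave f om v) /\
        nontrivial (plane_wave f om v),
      has_nontransverse_wave lam mu A f ->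
        exists c : R[i], forall fperp : 'rV[R]_3,
        dotprod (intvec R f) fperp = 0 -> enorm fperp = enorm (intvec R f) ->
        exists a2 a3 : R[i],
          [/\ solution lam mu A (w_Af lam mu f fperp a2 a3 c),
              nontrivial (w_Af lam mu f fperp a2 a3 c) &
              forall eps : R, eps < eps0 -> small A (C * eps) ->
                [/\ Normc.normc a2 + Normc.normc a3 <= C' * eps,
                    C' * eps <= 10^-1,
                    Normc.normc c
                      <= C'' * eps * enorm (intvec R f) ^+ 2 &
                    real_coefficients A ->
                      [/\ a2 \is Num.real, a3 \is Num.real
                        & c \is Num.real]]] &
      forall eps : R, eps < eps0 -> small A (C * eps) ->
        has_nontransverse_wave lam mu A f].
Proof.
(* With entries of B at most b = 9 C eps, the bounds 12 b on the eigenvalue and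
   64 b / L on each transverse amplitude give 108 C and 1152 C / L; eps0 makes
   C' eps0 equal to 1 / 10. *)
exists (108 * C) => lam mu mu0 L0; set L := lam + mu in L0.
have D_gt0 : 0 < 11520 * C by move: C_gt0; lra.
have budget eps : eps < L / (11520 * C) ->
    84 * (9 * (C * eps)) < L /\ 1152 * C / L * eps <= 10^-1.
  rewrite (ltr_pdivlMr _ _ D_gt0) mulrAC (ler_pdivrMr _ _ L0).
  have -> : eps * (11520 * C) = 11520 * (C * eps) by ring.
  have -> : 1152 * C * eps = 1152 * (C * eps) by ring.
  move: L0; clear; move: (C * eps) L => x l l0 hx.
  by split; lra.
exists (1152 * C / L), (L / (11520 * C)); split; first exact: divr_gt0.
move=> f A f0.
have len0 := len_gt0 R f0; set len := enorm (intvec R f) in len0.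
set e := cvec (direction R f).
set P := perturbed mu L e (coupling f A).
have u1 : dotprod (direction R f) (direction R f) = 1.
  exact: (unit_scaling f0 (erefl _)).
have e1 : dotprod e e = 1 := cvec_unit u1.
have e_le j : Normc.normc (e 0 j) <= 1 := cvec_unit_le1 j u1.
have fe (v : 'rV[R[i]]_3) :
    dotprod v e = (len^-1)%:C%C * dotprod (cvec (intvec R f)) v.
  by rewrite /e /cvec /direction map_mxZ dotprodZr dotprodC.
have near_wave eps : eps < L / (11520 * C) -> small A (C * eps) ->
    exists k v, [/\ v *m P = k *: v, dotprod v e = 1
      & Normc.normc (k - mu%:C%C - L%:C%C) < L / 4].
  move=> /budget[bs _] Asmall.
  exact: (exists_near_wave f0 mu L0 Asmall bs).
split.
- have [rs [rs_size rs_eig _]] := sum_eigenvalues (symbol lam mu A f).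
  case: rs rs_size rs_eig => // k rs _ /(_ k); rewrite inE eqxx => /(_ isT).
  move=> /eigenvalueP[v vk v0]; exists (sqrtc k), v; split.
    by apply/solution_plane_wave; rewrite sqr_sqrtc.
  exact: plane_wave_nontrivial.
- move=> nontransverse.
  (* A single eigenvector must serve every admissible eps, so it is taken close
     to e as soon as one of them exists; otherwise the given wave is used. *)
  have [k [v [vk ve near]]] : exists k v, [/\ v *m P = k *: v, dotprod v e = 1
      & forall eps, eps < L / (11520 * C) -> small A (C * eps) ->
        Normc.normc (k - mu%:C%C - L%:C%C) < L / 4].
    have [[eps [eps_lt Asmall]]|none] :=
        pselect (exists eps, eps < L / (11520 * C) /\ small A (C * eps)).
      have [k [v [vk ve kL]]] := near_wave eps eps_lt Asmall.
      by exists k, v.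
    have [om [v [/solution_plane_wave vom fv]]] := nontransverse.
    have lenC0 : (len ^+ 2)%:C%C != 0 :> R[i].
      by rewrite real_complex_neq0 // expf_neq0 // gt_eqF.
    have vP : v *m P = (om ^+ 2 / (len ^+ 2)%:C%C) *: v.
      by apply/(symbol_eigen f0); rewrite mulrC divfK.
    have ve : dotprod v e != 0.
      by rewrite fe mulf_neq0 // real_complex_neq0 // invr_neq0 ?gt_eqF.
    have [w [wP we]] := eigen_normalize vP ve.
    exists (om ^+ 2 / (len ^+ 2)%:C%C), w; split=> // eps lt sm.
    by case: none; exists eps.
  exists ((len ^+ 2)%:C%C * (mu%:C%C + L%:C%C - k)) => fperp orth same_len.
  pose u2 := len^-1 *: fperp; pose u3 := crossprod (direction R f) u2.
  have u2_unit : dotprod u2 u2 = 1 by apply: unit_scaling.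
  have u12 : dotprod (direction R f) u2 = 0.
    by rewrite dotprodZl dotprodZr orth !mulr0.
  have u3_unit : dotprod u3 u3 = 1.
    by rewrite lagrange_identity u1 u2_unit u12; ring.
  exists (dotprod v (cvec u2)), (dotprod v (cvec u3)).
  have om2 : ((lam + 2 * mu) * len ^+ 2)%:C%C
      - (len ^+ 2)%:C%C * (mu%:C%C + L%:C%C - k) = (len ^+ 2)%:C%C * k :> R[i].
    by rewrite /L !rmorphM !rmorphD /= rmorphM rmorph_nat; ring.
  have v0 : v != 0.
    apply: contra_eq_neq ve => ->.
    by rewrite /dotprod mul0mx mxE eq_sym oner_eq0.
  rewrite /w_Af -/len (wave_frame_expansion f0 orth same_len ve) om2; split.
  + apply/solution_plane_wave; rewrite sqr_sqrtc -scalemxAl.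
    by move/(symbol_eigen f0): vk => ->; rewrite !scalerA mulrC.
  + apply: plane_wave_nontrivial.
    by rewrite scaler_eq0 negb_or v0 andbT real_complex_neq0 // gt_eqF.
  move=> eps eps_lt Asmall; have [bs C'eps] := budget _ eps_lt.
  have Bs := coupling_le f0 Asmall; have kL := near _ eps_lt Asmall.
  have amp (u : 'rV[R]_3) : dotprod u u = 1 -> dotprod (direction R f) u = 0 ->
      Normc.normc (dotprod v (cvec u)) <= 64 * (9 * (C * eps)) / L.
    move=> uu du; apply: le_trans (transverse_amplitude v uu du) _.
    exact: (near_eigenvector L0 e1 e_le Bs bs vk kL ve).
  split=> //.
  + have u13 : dotprod (direction R f) u3 = 0 := dotprod_crossprodl _ _.
    apply: le_trans (lerD (amp _ u2_unit u12) (amp _ u3_unit u13)) _.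
    by rewrite le_eqVlt; apply/orP; left; apply/eqP; field; rewrite gt_eqF.
  + rewrite Normc.normcM normc_real ger0_norm ?sqr_ge0 // mulrC.
    rewrite ler_wpM2r ?sqr_ge0 //.
    have -> : 108 * C * eps = 12 * (9 * (C * eps)) by ring.
    have -> : mu%:C%C + L%:C%C - k = - (k - mu%:C%C - L%:C%C) by ring.
    by rewrite normcN (near_eigenvalue L0 e1 e_le Bs bs vk kL ve).
  move=> Areal.
  have [vreal kreal] := near_eigenvector_real L0 e1 e_le Bs bs
    (coupling_real f Areal) vk kL ve.
  have dot_real (u : 'rV[R]_3) : dotprod v (cvec u) \is Num.real.
    apply: conjc_fixed_real.
    by rewrite -[in RHS]vreal -[in RHS]map_conjc_cvec dotprod_map.
  have creal (x : R) : x%:C%C \is Num.real.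
    by apply: conjc_fixed_real; exact: conjc_real.
  split=> //; rewrite rpredM ?rpredB ?rpredD ?creal //.
  exact: conjc_fixed_real.
move=> eps eps_lt Asmall.
have [k [v [vk ve _]]] := near_wave eps eps_lt Asmall.
exists (sqrtc ((len ^+ 2)%:C%C * k)), v; split.
  by apply/solution_plane_wave; rewrite sqr_sqrtc; apply/(symbol_eigen f0).
by apply: contra_eq_neq ve => fv; rewrite fe fv mulr0 eq_sym oner_eq0.
Qed.
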